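(* Let $G=S_k$, $k\ge 3$, be the star graph on $n=k$ nodes, with signless Laplacian spectrum $S_Q(G)=\{q_1,q_2,\dots,q_n\}$, $q_1\le q_2\le\dots\le q_n$, and let $G^{(1)}=G\circ G$. Then $S_Q(G^{(1)})$ is given by the following. (a) $\lambda_z=X^z+\frac{q_i+2k+2}{3}\in S_Q(G^{(1)})$ with multiplicity $1$ ($i=1,\dots,n$); (b) $q_j+1\in S_Q(G^{(1)})$ for $j=2,\dots,n-1$, each with multiplicity $k$. Here $z=1,2,3$ correspond to the three angles $\frac{\theta}{3},\frac{2\pi+\theta}{3},\frac{4\pi+\theta}{3}$, namely $$X^z=\frac23\cos\Bigl(\frac{y\pi+\theta}{3}\Bigr)\sqrt{q_i^2+q_i(k-2)+(k+1)^2},\qquad y=0,2,4,$$ $$\theta=\cos^{-1}\left(\frac{2q_i^3+(3k-6)q_i^2-3(k^2-k-2)q_i+\bigl(70k-94-12\sum_{a=1}^{k-2}(a+2)(k-a-1)\bigr)}{2\bigl(q_i^2+q_i(k-2)+(k+1)^2\bigr)^{3/2}}\right).$$ Moreover, $$\lambda_z\in\Bigl[-q_i+\frac{2q_i}{3}+\frac{Y-(A+\sqrt{4B-A^2})}{3},\ q_i+\frac{Y+A+\sqrt{4B-A^2}}{3}\Bigr],$$ where $A=k-2$, $B=(k+1)^2$, $Y=2k+2$.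
   Context: The star graph $S_k$ has $k$ nodes: one center joined to $k-1$ leaves. The corona product $G_1\circ G_2$ of two graphs is obtained by taking one copy of $G_1$ and $|V(G_1)|$ copies of $G_2$, and joining the $i$-th node of $G_1$ to every node of the $i$-th copy of $G_2$, for each $i$. $S_Q(H)$ denotes the spectrum of the signless Laplacian matrix $Q(H)=D(H)+A(H)$ (degree matrix plus adjacency matrix).
   Formalization: The constant 70k−94 in the numerator of θ is corrected to 70k−86; with 94 the claim fails, e.g. for k=3, q_1=0 the three λ_z would be roots of x³−8x²+16x−208/27, which cannot all be eigenvalues of an integer matrix. *)

(* Defs.v *)
(* MathComp / MathComp-Analysis. *)
From HB Require Import structures.
From mathcomp Require Import all_boot all_order all_algebra.
From mathcomp Require Import all_classical all_reals all_analysis.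

Set Implicit Arguments.
Unset Strict Implicit.
Unset Printing Implicit Defensive.

Import Order.TTheory GRing.Theory Num.Theory.
Local Open Scope ring_scope.

Record sgraph := SGraph {
  svertex :> finType;
  sedge : rel svertex;
  sedge_sym : symmetric sedge;
  sedge_irrefl : irreflexive sedge }.

(* The centre is vertex 0; u and v are adjacent iff exactly one of them is the
   centre. *)
Definition star_edge (k : nat) : rel 'I_k :=
  fun u v => (val u == 0%N) (+) (val v == 0%N).

Lemma star_edge_sym k : symmetric (@star_edge k).
Proof. by move=> u v; rewrite /star_edge addbC. Qed.

Lemma star_edge_irrefl k : irreflexive (@star_edge k).
Proof. by move=> u; rewrite /star_edge addbb. Qed.

Definition star (k : nat) : sgraph :=
  SGraph (@star_edge_sym k) (@star_edge_irrefl k).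

(* inl u is the vertex u of G1; inr (w, a) is the vertex a of the copy of G2
   attached to the vertex w of G1. *)
Definition corona_edge (G1 G2 : sgraph) : rel (G1 + G1 * G2)%type :=
  fun x y => match x, y with
  | inl u, inl v => sedge u v
  | inl u, inr (w, _) => u == w
  | inr (w, _), inl u => u == w
  | inr (w, a), inr (w', b) => (w == w') && sedge a b
  end.

Lemma corona_edge_sym G1 G2 : symmetric (@corona_edge G1 G2).
Proof.
move=> [u|[w a]] [v|[w' b]] //=; first exact: sedge_sym.
by rewrite eq_sym sedge_sym.
Qed.

Lemma corona_edge_irrefl G1 G2 : irreflexive (@corona_edge G1 G2).
Proof. by move=> [u|[w a]] /=; rewrite sedge_irrefl ?andbF. Qed.

Definition corona (G1 G2 : sgraph) : sgraph :=
  SGraph (@corona_edge_sym G1 G2) (@corona_edge_irrefl G1 G2).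

Definition degree (G : sgraph) (u : G) : nat := #|[set v | sedge u v]|.

Definition adjacency_mx (R : pzRingType) (G : sgraph) : 'M[R]_#|G| :=
  \matrix_(i, j) (sedge (enum_val i) (enum_val j))%:R.

Definition degree_mx (R : pzRingType) (G : sgraph) : 'M[R]_#|G| :=
  diag_mx (\row_i (degree (enum_val i))%:R).

Definition signless_laplacian (R : pzRingType) (G : sgraph) : 'M[R]_#|G| :=
  degree_mx R G + adjacency_mx R G.

(* s lists all eigenvalues of M, each repeated according to its multiplicity;
   such an s is unique up to permutation. *)
Definition is_spectrum (R : comNzRingType) (n : nat) (M : 'M[R]_n) (s : seq R) :
  Prop := char_poly M = \prod_(x <- s) ('X - x%:P).

Section StarCoronaEigenvalues.
Variables (R : realType) (k : nat) (q : R).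

Let K : R := k%:R.

Definition radicand : R := q ^+ 2 + q * (K - 2) + (K + 1) ^+ 2.

(* The eigenvalues attached to q are the roots of the cubic
     (l - q - K) * (l - 1) * (l - 1 - K) = K * (l - 1) - (K - 2) ^+ 2,
   and theta comes from its trigonometric solution.  Expanding this cubic gives
   70 K - 86 below, and not 70 K - 94 as in the printed source: with 94,
   K = 3 and q = 0 would give a monic cubic with a non-integral rational
   coefficient for three eigenvalues of an integer matrix. *)
Definition theta_numerator : R :=
  2 * q ^+ 3 + (3 * K - 6) * q ^+ 2 - 3 * (K ^+ 2 - K - 2) * q
  + (70 * K - 86
     - 12 * \sum_(1 <= a < k.-1) (a%:R + 2) * (K - a%:R - 1)).

Definition theta : R := acos (theta_numerator / (2 * radicand `^ (3 / 2))).

(* The three angles are obtained for y = 0, 2, 4. *)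
Definition X_y (y : nat) : R :=
  2 / 3 * cos ((y%:R * pi + theta) / 3) * Num.sqrt radicand.

Definition lambda_y (y : nat) : R := X_y y + (q + 2 * K + 2) / 3.

End StarCoronaEigenvalues.

(* Main.v *)
(* Order the vertices of the corona as the k base vertices, the k centres of the
   copies and the k (k - 1) leaves.  The characteristic matrix then has blocks
     [[(x - k) I - Q, -I, -J], [-I, (x - k) I, -J], [-J^T, -J^T, (x - 2) I]]
   with J J^T = (k - 1) I, and its last two diagonal blocks are scalar.  Eliminating
   them one after the other leaves det (a I - b Q), where Q is the signless
   Laplacian of the star and a - b q = (x - 2) f_q for a monic cubic f_q; the same
   elimination gives det (a I - b Q) = a (a - b)^(k-2) (a - b k).  Hence Q has
   spectrum 0, 1, ..., 1, k and the corona has characteristic polynomial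
   (x - 2)^(k (k-2)) times the product of the f_q.  Since f_q is nonnegative at 1
   and nonpositive at k + 1, its discriminant is nonnegative and the trigonometric
   formula gives its three roots. *)
Require Import Defs.
From HB Require Import structures.
From mathcomp Require Import all_boot all_order all_algebra.
From mathcomp Require Import all_classical all_reals all_analysis.
From mathcomp Require Import perm ring lra.

Set Implicit Arguments.
Unset Strict Implicit.
Unset Printing Implicit Defensive.

Import Order.TTheory GRing.Theory Num.Theory.
Local Open Scope ring_scope.

(** This is the monic cubic f_q left by the elimination. The parameter is itself a polynomial, so
    that the elimination is a [ring] identity in [{poly R}] and constants and numerals can both be
    substituted. *)
Definition corona_cubic (R : nzRingType) (k : nat) (q : {poly R}) : {poly R} :=
  ('X - k%:R - q) * ('X - 1) * ('X - 1 - k%:R) - k%:R * ('X - 1) + (k%:R - 2) ^+ 2.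

(** * Trigonometric and real-variable facts about cubics *)

Lemma cos_triple (R : realType) (x : R) : cos (3 * x) = 4 * cos x ^+ 3 - 3 * cos x.
Proof.
have -> : 3 * x = x + x + x by ring.
rewrite !cosD sinD; have := cos2Dsin2 x; move: (cos x) (sin x) => c s h.
have -> : s * s = 1 - c ^+ 2 by rewrite -h; ring.
have -> : (s * c + c * s) * s = 2 * c * (s ^+ 2) by ring.
have -> : s ^+ 2 = 1 - c ^+ 2 by rewrite -h; ring.
ring.
Qed.

(** The triple-angle formula at pi / 3 gives 4 c^3 - 3 c + 1 = 0, that is (c + 1) (2 c - 1)^2 = 0,
    and c is positive. *)
Lemma cos_pi_third (R : realType) : cos (pi / 3) = 2^-1 :> R.
Proof.
have p0 := pi_gt0 R.
have c0 : 0 < cos (pi / 3 : R) by apply: cos_gt0_pihalf; apply/andP; split; lra.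
have := cos_triple (pi / 3 : R); rewrite mulrC divfK ?pnatr_eq0// cospi.
move: (cos _) c0 => c c0 e.
have : (c + 1) * (2 * c - 1) ^+ 2 = 0.
  have -> : (c + 1) * (2 * c - 1) ^+ 2 = 4 * c ^+ 3 - 3 * c + 1 by ring.
  by rewrite -e addNr.
move/eqP; rewrite mulf_eq0 gt_eqF ?addr_gt0//= expf_eq0/= => /eqP; lra.
Qed.

(** By the triple-angle formula the three cosines are the roots of 4 X^3 - 3 X - cos t; these are
    its Vieta relations. The last two cosines are -cos(t/3)/2 -+ h sin(t/3) with h^2 = 3/4, so [h]
    enters the symmetric functions only through its square. *)
Lemma third_angles (R : realType) (t : R) :
  let c y := cos ((y%:R * pi + t) / 3) in
  [/\ c 0%N + c 2%N + c 4%N = 0,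
      c 0%N * c 2%N + c 0%N * c 4%N + c 2%N * c 4%N = - (3 / 4) &
      c 0%N * c 2%N * c 4%N = cos t / 4].
Proof.
move=> c; pose x := t / 3; pose h : R := sin (pi / 3 + pi / 3).
have c2 : cos (pi / 3 + pi / 3) = - 2^-1 :> R.
  by rewrite cosD; have := cos2Dsin2 (pi / 3 : R); rewrite cos_pi_third; nra.
have hh : h ^+ 2 = 3 / 4.
  by have := cos2Dsin2 (pi / 3 + pi / 3 : R); rewrite c2 -/h; lra.
have c4 : cos (pi / 3 + pi / 3 + (pi / 3 + pi / 3)) = - 2^-1 :> R.
  by rewrite [LHS]cosD c2 -/h -(expr2 h) hh; lra.
have s4 : sin (pi / 3 + pi / 3 + (pi / 3 + pi / 3)) = - h.
  by rewrite [LHS]sinD c2 -/h; lra.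
have -> : c 0%N = cos x by rewrite /c mul0r add0r.
have -> : c 2%N = - 2^-1 * cos x - h * sin x.
  by rewrite /c -c2 -cosD; congr cos; rewrite /x; field.
have -> : c 4%N = - 2^-1 * cos x + h * sin x.
  transitivity (cos (pi / 3 + pi / 3 + (pi / 3 + pi / 3) + x)).
    by rewrite /c; congr cos; rewrite /x; field.
  by rewrite cosD c4 s4; ring.
have -> : cos t = 4 * cos x ^+ 3 - 3 * cos x.
  by rewrite -cos_triple; congr cos; rewrite /x; field.
have ss : sin x ^+ 2 = 1 - cos x ^+ 2 by rewrite -(cos2Dsin2 x); ring.
have hs : (h * sin x) ^+ 2 = 3 / 4 * (1 - cos x ^+ 2) by rewrite exprMn hh ss.
move: (cos x) (h * sin x) hs => a b hs; split.
- by field.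
- have -> : a * (- 2^-1 * a - b) + a * (- 2^-1 * a + b) +
    (- 2^-1 * a - b) * (- 2^-1 * a + b) = - (3 / 4) * a ^+ 2 - b ^+ 2 by field.
  by rewrite hs; field.
- have -> : a * (- 2^-1 * a - b) * (- 2^-1 * a + b) =
    a * (4^-1 * a ^+ 2 - b ^+ 2) by field.
  by rewrite hs; field.
Qed.

(** Write p(x) = x^3 - 3 s^2 x - r, with critical values -r + 2 s^3 at -s and -r - 2 s^3 at s. If
    both were positive, p(b) <= 0 would force b < -2 s; if both were negative, p(a) >= 0 would force
    a > 2 s. In either case p would increase strictly from a to b, against the signs. *)
Lemma depressed_cubic_bound (R : realFieldType) (s r a b : R) :
  0 <= s -> a < b -> 0 <= a ^+ 3 - 3 * s ^+ 2 * a - r ->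
  b ^+ 3 - 3 * s ^+ 2 * b - r <= 0 -> - (2 * s ^+ 3) <= r <= 2 * s ^+ 3.
Proof.
move=> s0 ab fa fb.
(* The expression is the difference quotient (p(b) - p(a)) / (b - a). *)
have incr : 0 < a ^+ 2 + a * b + b ^+ 2 - 3 * s ^+ 2 -> False.
  move=> h; have : 0 < (b - a) * (a ^+ 2 + a * b + b ^+ 2 - 3 * s ^+ 2).
    by rewrite mulr_gt0// subr_gt0.
  have -> : (b - a) * (a ^+ 2 + a * b + b ^+ 2 - 3 * s ^+ 2) =
    (b ^+ 3 - 3 * s ^+ 2 * b - r) - (a ^+ 3 - 3 * s ^+ 2 * a - r) by ring.
  lra.
apply/andP; split; rewrite leNgt; apply/negP => rs; apply: incr.
- have : (b + 2 * s) * (b - s) ^+ 2 < 0.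
    have -> : (b + 2 * s) * (b - s) ^+ 2 =
      b ^+ 3 - 3 * s ^+ 2 * b - r + (r + 2 * s ^+ 3) by ring.
    lra.
  have [bs|bs] := leP 0 (b + 2 * s).
    by move=> h; have := mulr_ge0 bs (sqr_ge0 (b - s)); lra.
  by move=> _; nra.
- have : 0 < (a - 2 * s) * (a + s) ^+ 2.
    have -> : (a - 2 * s) * (a + s) ^+ 2 =
      a ^+ 3 - 3 * s ^+ 2 * a - r + (r - 2 * s ^+ 3) by ring.
    lra.
  have [bs|bs] := leP (a - 2 * s) 0.
    by move=> h; have := mulr_le0_ge0 bs (sqr_ge0 (a + s)); lra.
  by move=> _; nra.
Qed.

(** Used with x = K - 1 and m = k - 2, to evaluate the sum inside [theta_numerator]. *)
Lemma sum_shifted_products (R : numFieldType) (x : R) (m : nat) :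
  \sum_(1 <= a < m.+1) (a%:R + 2) * (x - a%:R) =
  x * (m%:R * (m%:R + 5) / 2) - m%:R * (m%:R + 1) * (2 * m%:R + 7) / 6.
Proof.
elim: m => [|m IHm]; first by rewrite big_geq//; field.
by rewrite big_nat_recr//= IHm -natr1; field.
Qed.

(** * The trigonometric roots of the cubic and their bounds *)

Section CubicRoots.
Variables (R : realType) (k : nat) (q : R).
Hypothesis k_ge3 : (3 <= k)%N.

Local Notation K := (k%:R : R).

Let K3 : 3 <= K. Proof. by rewrite ler_nat. Qed.

Lemma radicand_gt0 : 0 < radicand k q.
Proof.
rewrite /radicand.
have -> : q ^+ 2 + q * (K - 2) + (K + 1) ^+ 2 =
  ((2 * q + K - 2) ^+ 2 + 3 * K * (K + 4)) / 4 by field.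
rewrite divr_gt0// ltr_wpDl ?sqr_ge0// !mulr_gt0//; have := K3; lra.
Qed.

Lemma theta_numeratorE : theta_numerator k q =
  2 * q ^+ 3 + (3 * K - 6) * q ^+ 2 - 3 * (K ^+ 2 - K - 2) * q
  - 2 * K ^+ 3 - 6 * K ^+ 2 + 102 * K - 110.
Proof.
rewrite /theta_numerator.
have -> : k.-1 = k.-2.+1 by case: k k_ge3 => [|[]].
under eq_bigr => a _ do rewrite addrAC.
rewrite sum_shifted_products.
have -> : k.-2%:R = K - 2 :> R by rewrite -subn2 natrB// ltnW.
by field.
Qed.

Lemma cos_theta :
  2 * Num.sqrt (radicand k q) ^+ 3 * cos (theta k q) = theta_numerator k q.
Proof.
have r0 := radicand_gt0; set r := Num.sqrt _.
have rr : r ^+ 2 = radicand k q by rewrite sqr_sqrtr// ltW.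
have rp : 0 < r by rewrite sqrtr_gt0.
have -> : theta k q = acos (theta_numerator k q / (2 * r ^+ 3)).
  rewrite /theta; congr (acos (_ / (2 * _))).
  have -> : 3 / 2 = 1 + 2^-1 :> R by field.
  rewrite powRD ?gt_eqF ?implybT// powR12_sqrt ?ltW// powRr1 ?ltW// -/r -rr.
  by rewrite [RHS]exprSr.
have d0 : 0 < 2 * r ^+ 3 by rewrite mulr_gt0// exprn_gt0.
set d := 2 * r ^+ 3 in d0 *.
(* [acos] inverts [cos] only on [-1, 1]; membership there says that the discriminant of the cubic is
   nonnegative. *)
suff /acosK -> : theta_numerator k q / d \in `[(-1), 1].
  by rewrite mulrC divfK ?gt_eqF.
rewrite in_itv/=.
(* A third of the sum of the roots: the shift by [m] turns the cubic into X^3 - 3 (r/3)^2 X -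
   [theta_numerator] / 27. *)
pose m := (q + 2 * K + 2) / 3.
(* The cubic takes the values (K - 2)^2 at 1 and 4 - 4 K at K + 1. *)
have /andP[] : - (2 * (r / 3) ^+ 3) <= theta_numerator k q / 27 <= 2 * (r / 3) ^+ 3.
  apply: (@depressed_cubic_bound _ _ _ (1 - m) (K + 1 - m)).
  - by rewrite divr_ge0// ltW.
  - by have := K3; lra.
  - rewrite expr_div_n rr theta_numeratorE /m /radicand.
    have -> : (1 - (q + 2 * K + 2) / 3) ^+ 3 - 3 *
      ((q ^+ 2 + q * (K - 2) + (K + 1) ^+ 2) / 3 ^+ 2) *
      (1 - (q + 2 * K + 2) / 3) - (2 * q ^+ 3 + (3 * K - 6) * q ^+ 2 -
      3 * (K ^+ 2 - K - 2) * q - 2 * K ^+ 3 - 6 * K ^+ 2 + 102 * K - 110) / 27 =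
      (K - 2) ^+ 2 by field.
    exact: sqr_ge0.
  - rewrite expr_div_n rr theta_numeratorE /m /radicand.
    have -> : (K + 1 - (q + 2 * K + 2) / 3) ^+ 3 - 3 *
      ((q ^+ 2 + q * (K - 2) + (K + 1) ^+ 2) / 3 ^+ 2) *
      (K + 1 - (q + 2 * K + 2) / 3) - (2 * q ^+ 3 + (3 * K - 6) * q ^+ 2 -
      3 * (K ^+ 2 - K - 2) * q - 2 * K ^+ 3 - 6 * K ^+ 2 + 102 * K - 110) / 27 =
      4 - 4 * K by field.
    by have := K3; lra.
rewrite expr_div_n => l u; rewrite /d ler_pdivlMr// ler_pdivrMr//.
by apply/andP; split; lra.
Qed.

(** Each root is m + (2/3) r c_y, with c_y one of the three cosines. The coefficients therefore
    reduce to the symmetric functions of [third_angles], and [cos_theta] removes the angle. *)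
Lemma prod_lambda :
  \prod_(y <- [:: 0; 2; 4]%N) ('X - (lambda_y k q y)%:P) =
  corona_cubic k q%:P.
Proof.
rewrite /corona_cubic.
have [] := third_angles (theta k q); have := cos_theta.
have := sqr_sqrtr (ltW radicand_gt0).
rewrite !big_cons big_nil mulr1 /lambda_y /X_y theta_numeratorE.
have -> : k%:R = K%:P :> {poly R} by rewrite polyC_natr.
have -> : 2 = 2%:P :> {poly R} by rewrite polyC_natr.
move: (cos _) (cos _) (cos _) (cos (theta k q)) (Num.sqrt _).
move=> c4 c2 c0 c r rr rc e1 e2 e3.
pose m := (q + 2 * K + 2) / 3.
have vieta (a b d : R) : ('X - a%:P) * (('X - b%:P) * ('X - d%:P)) =
    'X ^+ 3 - (a + b + d)%:P * 'X ^+ 2 + (a * b + a * d + b * d)%:P * 'X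
    - (a * b * d)%:P.
  by rewrite !(polyCD, polyCM); ring.
rewrite vieta.
have -> : 2 / 3 * c0 * r + (q + 2 * K + 2) / 3 + (2 / 3 * c2 * r +
    (q + 2 * K + 2) / 3) + (2 / 3 * c4 * r + (q + 2 * K + 2) / 3) =
    q + K + 2 + K.
  have -> : q + K + 2 + K = 2 / 3 * r * (c0 + c2 + c4) + (q + 2 * K + 2).
    by rewrite e1; field.
  by field.
set E2 := (X in X%:P * 'X); set E3 := (X in _ - X%:P).
have -> : E2 = (q + K) * (K + 2) + 1.
  have -> : E2 = 4 / 9 * r ^+ 2 * (c0 * c2 + c0 * c4 + c2 * c4) +
    4 / 3 * m * r * (c0 + c2 + c4) + 3 * m ^+ 2 by rewrite /E2 /m; field.
  by rewrite e1 e2 rr /radicand /m; field.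
have -> : E3 = (q + K) * (K + 1) - K - (K - 2) ^+ 2.
  have -> : E3 = 8 / 27 * r ^+ 3 * (c0 * c2 * c4) +
    4 / 9 * m * r ^+ 2 * (c0 * c2 + c0 * c4 + c2 * c4) +
    2 / 3 * m ^+ 2 * r * (c0 + c2 + c4) + m ^+ 3 by rewrite /E3 /m; field.
  have -> : 8 / 27 * r ^+ 3 * (c0 * c2 * c4) = (2 * r ^+ 3 * c) / 27.
    by rewrite e3; field.
  by rewrite e1 e2 rc rr /radicand /m; field.
by rewrite !(polyCD, polyCB, polyCM, polyCN, polyC_exp); ring.
Qed.

(** Since a cosine is at most 1 in absolute value, [lambda_y] lies within 2 r / 3 of (q + 2 K + 2) /
    3, and 2 r <= 2 q + A + S. *)
Lemma lambda_bounds (A S : R) (y : nat) : 0 <= q -> A = K - 2 ->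
  S = Num.sqrt (4 * (K + 1) ^+ 2 - A ^+ 2) ->
  - q + 2 * q / 3 + (2 * K + 2 - (A + S)) / 3 <= lambda_y k q y
    <= q + (2 * K + 2 + A + S) / 3.
Proof.
move=> q0 defA defS.
have SS : S ^+ 2 = 4 * (K + 1) ^+ 2 - A ^+ 2.
  rewrite defS sqr_sqrtr// defA.
  have -> : 4 * (K + 1) ^+ 2 - (K - 2) ^+ 2 = 3 * K * (K + 4) by ring.
  by rewrite !mulr_ge0//; have := K3; lra.
have S0 : 0 <= S by rewrite defS sqrtr_ge0.
have A0 : 0 <= A by rewrite defA; have := K3; lra.
rewrite /lambda_y /X_y; set r := Num.sqrt _; set c := cos _.
have r0 : 0 <= r by exact: sqrtr_ge0.
have rr : r ^+ 2 = q ^+ 2 + q * A + (K + 1) ^+ 2.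
  by rewrite defA sqr_sqrtr// ltW// radicand_gt0.
(* 4 r^2 = (2 q + A)^2 + S^2 *)
have rle : 2 * r <= 2 * q + A + S.
  rewrite -ler_sqr ?nnegrE; [|lra..].
  rewrite exprMn rr; have := mulr_ge0 q0 S0; have := mulr_ge0 A0 S0; nra.
have : `|c * r| <= r by rewrite normrM (ger0_norm r0) ler_piMl// cos_max.
rewrite ler_norml => /andP[l u].
have -> : 2 / 3 * c * r = 2 / 3 * (c * r) by ring.
by apply/andP; split; lra.
Qed.

End CubicRoots.

(** * Determinants of block matrices, of relabelled matrices and of the star pencil *)

Lemma det_block_scalar (R : comNzRingType) m p (A : 'M[R]_m)
    (B : 'M[R]_(m, p)) (C : 'M[R]_(p, m)) (d : R) :
  \det (block_mx A B C d%:M) * d ^+ m = \det (d *: A - B *m C) * d ^+ p.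
Proof.
(* A Schur complement without division: multiplying on the right by this block matrix clears the
   lower left block, because the scalar block commutes with [C]. *)
have <- : \det (block_mx (d%:M : 'M[R]_m) 0 (- C) (1%:M : 'M[R]_p)) = d ^+ m.
  by rewrite det_lblock det1 mulr1 det_scalar.
rewrite -det_mulmx mulmx_block !(mulmx0, mulmx1, add0r, mul_mx_scalar) !mulmxN.
by rewrite mul_scalar_mx subrr det_ublock det_scalar.
Qed.

(** Rows and columns are permuted alike, so the two signs cancel. This replaces the default
    enumeration by any convenient order. *)
Lemma det_enum_val (R : comNzRingType) (T : finType) (F : T -> T -> R) (m : nat)
    (g : 'I_m -> T) : injective g -> m = #|T| ->
  \det (\matrix_(i, j < #|T|) F (enum_val i) (enum_val j)) =
  \det (\matrix_(i, j < m) F (g i) (g j)).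
Proof.
move=> g_inj def_m; subst m.
have s_inj : injective (fun i => enum_rank (g i)).
  by move=> i j /enum_rank_inj /g_inj.
set M := \matrix_(i, j) _; set N := \matrix_(i, j) _.
have -> : N = row_perm (perm s_inj) (col_perm (perm s_inj) M).
  by apply/matrixP => i j; rewrite !mxE !permE !enum_rankK.
rewrite row_permE col_permE !det_mulmx !det_perm odd_permV mulrCA.
by rewrite -signr_addb addbb mulr1.
Qed.

(** The signless Laplacian of the star on [n.+1] vertices, centre first, as [star_QE] confirms. *)
Definition star_Q (R : pzRingType) (n : nat) : 'M[R]_(1 + n) :=
  block_mx n%:R%:M (const_mx 1) (const_mx 1) 1%:M.

(** The leaf block is the scalar a - b, so eliminating it leaves a 1 x 1 determinant. The form with
    two coefficients serves both the star (a = 'X, b = 1) and the corona. *)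
Lemma det_star_pencil (R : idomainType) (n : nat) (a b : R) :
  (0 < n)%N -> a - b != 0 ->
  \det (a%:M - b *: star_Q R n) = a * (a - b) ^+ n.-1 * (a - b * n.+1%:R).
Proof.
case: n => // n _ ab.
have -> : a%:M - b *: star_Q R n.+1 = block_mx (a - b * n.+1%:R)%:M
    (const_mx (- b)) (const_mx (- b)) (a - b)%:M.
  rewrite /star_Q (scalar_mx_block 1 n.+1) scale_block_mx opp_block_mx.
  rewrite add_block_mx !scale_scalar_mx !add0r -!raddfB mulr1.
  by congr block_mx; apply/matrixP => i j; rewrite !mxE mulr1.
apply: (mulIf ab); rewrite -[X in _ * X]expr1 det_block_scalar.
rewrite [\det _](_ : _ = a * (a - b * n.+2%:R)).
  by rewrite exprS /=; ring.
rewrite det_mx11 !mxE eqxx mulr1n.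
under eq_bigr do rewrite !mxE.
by rewrite sumr_const card_ord -mulr_natl -[n.+2%:R]natr1; ring.
Qed.

(** * Degrees, and the characteristic polynomial of the star *)

Lemma degree_sum (G : sgraph) (u : G) : degree u = (\sum_v sedge u v)%N.
Proof.
rewrite /degree cardsE -sum1_card big_mkcond; apply: eq_bigr => v _.
by rewrite unfold_in -[LHS]/(if sedge u v then 1 else 0)%N; case: sedge.
Qed.

Lemma degree_corona_inl (G1 G2 : sgraph) (u : G1) :
  degree (inl u : corona G1 G2) = (degree u + #|G2|)%N.
Proof.
rewrite !degree_sum big_sumType/=; congr addn.
transitivity (\sum_(w : G1) \sum_(a : G2) (u == w))%N.
  by rewrite pair_bigA; apply: eq_bigr => -[].
rewrite (bigD1 u)//= [X in (_ + X)%N]big1 ?addn0; last first.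
  by move=> w /negbTE wu; rewrite big1// => a _; rewrite [u == w]eq_sym wu.
by rewrite eqxx sum1_card.
Qed.

Lemma degree_corona_inr (G1 G2 : sgraph) (w : G1) (a : G2) :
  degree (inr (w, a) : corona G1 G2) = (degree a).+1.
Proof.
rewrite !degree_sum big_sumType/= -add1n; congr addn.
  by rewrite (bigD1 w)//= eqxx big1 ?addn0// => u /negbTE ->.
transitivity (\sum_w' \sum_b ((w == w') && sedge a b))%N.
  by rewrite pair_bigA; apply: eq_bigr => -[].
rewrite (bigD1 w)//= [X in (_ + X)%N]big1 ?addn0; last first.
  by move=> u /negbTE uw; rewrite big1// => a' _; rewrite [w == u]eq_sym uw.
by apply: eq_bigr => b _; rewrite eqxx.
Qed.

Lemma degree_star_center n : degree (ord0 : star n.+1) = n.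
Proof.
by rewrite degree_sum big_ord_recl/= sum_nat_const card_ord muln1.
Qed.

Lemma degree_star_leaf n (a : 'I_n) : degree (lift ord0 a : star n.+1) = 1%N.
Proof. by rewrite degree_sum big_ord_recl/= big1. Qed.

Lemma char_poly_signless (R : comNzRingType) (G : sgraph) (m : nat) (g : 'I_m -> G) :
  injective g -> m = #|G| ->
  char_poly (signless_laplacian R G) = \det (\matrix_(i, j < m)
    (('X - (degree (g i))%:R) *+ (i == j) - (sedge (g i) (g j))%:R)).
Proof.
move=> g_inj def_m; pose F u v : {poly R} :=
  ('X - (degree u)%:R) *+ (u == v) - (@sedge G u v)%:R.
transitivity (\det (\matrix_(i, j < #|G|) F (enum_val i) (enum_val j))).
  congr (\det _); apply/matrixP => i j.
  rewrite !mxE /F (inj_eq enum_val_inj) rmorphD rmorphMn/= !polyC_natr.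
  by rewrite opprD addrA mulrnBl.
rewrite (det_enum_val F g_inj def_m); congr (\det _); apply/matrixP => i j.
by rewrite !mxE /F (inj_eq g_inj).
Qed.

Lemma star_QE (R : pzRingType) n (u v : star n.+1) :
  star_Q R n u v = (degree u)%:R *+ (u == v) + (sedge u v)%:R.
Proof.
have l0 (i : 'I_1) : lshift n i = ord0 by rewrite ord1; apply: val_inj.
have r0 (i : 'I_n) : rshift 1 i = lift ord0 i by apply: val_inj.
rewrite /star_Q; case: (@split_ordP 1 n u) => u' ->;
  case: (@split_ordP 1 n v) => v' ->.
- by rewrite block_mxEul mxE !l0 !ord1 degree_star_center eqxx addr0.
- by rewrite block_mxEur mxE l0 r0 add0r.
- by rewrite block_mxEdl mxE l0 r0 add0r.
- rewrite block_mxEdr mxE !r0 degree_star_leaf (inj_eq lift_inj) addr0.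
  by case: eqP.
Qed.

Lemma char_poly_star (R : idomainType) n : (0 < n)%N ->
  char_poly (signless_laplacian R (star n.+1)) =
  'X * ('X - 1) ^+ n.-1 * ('X - n.+1%:R).
Proof.
move=> n_gt0.
rewrite (@char_poly_signless _ (star n.+1) n.+1 id) ?card_ord//.
rewrite -[n.+1%:R]mul1r -det_star_pencil//; last first.
  by rewrite -polyC1 polyXsubC_eq0.
congr (\det _); apply/matrixP => i j.
by rewrite [LHS]mxE scale1r mxE mxE [in RHS]mxE star_QE mulrnBl opprD addrA.
Qed.

(** * The characteristic polynomial of the corona *)

Section CoronaOfStars.
Variables (R : numDomainType) (n : nat).
Hypothesis n_ge2 : (1 < n)%N.

(** The pair (w, a) stands for the leaf [lift ord0 a] of the copy attached to w. *)
Let leaf : finType := ('I_n.+1 * 'I_n)%type.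

Let vertex_of (i : 'I_(n.+1 + n.+1 + #|leaf|)) : corona (star n.+1) (star n.+1) :=
  match fintype.split i with
  | inl j => match fintype.split j with inl u => inl u | inr w => inr (w, ord0) end
  | inr l => inr ((enum_val l).1, lift ord0 (enum_val l).2)
  end.

Let vertex_of_base u : vertex_of (lshift _ (lshift _ u)) = inl u.
Proof. by rewrite /vertex_of !(unsplitK (inl _)). Qed.

Let vertex_of_center w : vertex_of (lshift _ (rshift _ w)) = inr (w, ord0).
Proof. by rewrite /vertex_of (unsplitK (inl _)) (unsplitK (inr _)). Qed.

Let vertex_of_leaf l :
  vertex_of (rshift _ l) = inr ((enum_val l).1, lift ord0 (enum_val l).2).
Proof. by rewrite /vertex_of (unsplitK (inr _)). Qed.

Let vertex_of_inj : injective vertex_of.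
Proof.
move=> i j.
case: (split_ordP i) => [i' ->|l ->]; case: (split_ordP j) => [j' ->|l' ->].
- case: (split_ordP i') => [u ->|w ->]; case: (split_ordP j') => [u' ->|w' ->];
    by rewrite ?vertex_of_base ?vertex_of_center // => -[->].
- by case: (split_ordP i') => [u ->|w ->];
    rewrite ?vertex_of_base ?vertex_of_center vertex_of_leaf.
- by case: (split_ordP j') => [u ->|w ->];
    rewrite ?vertex_of_base ?vertex_of_center vertex_of_leaf.
- rewrite !vertex_of_leaf => -[e1 e2]; congr rshift; apply: enum_val_inj.
  by apply/eqP/andP; split; apply/eqP=> //; exact: val_inj.
Qed.

Let card_vertices :
  (n.+1 + n.+1 + #|leaf|)%N = #|corona (star n.+1) (star n.+1)|.
Proof. by rewrite card_sum /leaf !card_prod !card_ord -addnA -mulnS. Qed.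

(** A base vertex and the centre of its copy are adjacent to the same leaves, so [J] serves both. *)
Let J : 'M[{poly R}]_(n.+1, #|leaf|) :=
  \matrix_(i, l) ((enum_val l).1 == i)%:R.

Let mulJJ : J *m J^T = n%:R%:M.
Proof.
apply/matrixP => i j; rewrite !mxE.
under eq_bigr do rewrite !mxE.
transitivity (\sum_(w : 'I_n.+1) \sum_(a : 'I_n) (w == i)%:R * (w == j)%:R : {poly R}).
  by rewrite pair_bigA [RHS]big_enum_val.
rewrite (bigD1 i)//= [X in _ + X]big1 ?addr0; last first.
  by move=> w /negbTE wi; rewrite big1// => a _; rewrite wi mul0r.
by rewrite sumr_const card_ord eqxx mul1r mulrb; case: eqP => // _; rewrite mul0rn.
Qed.

(** Degrees account for the diagonal: a base vertex gains [n.+1] neighbours over its degree in the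
    star, a centre has n + 1 in all, and a leaf has 2. *)
Let charmx_blocks :
  \matrix_(i, j) (('X - (degree (vertex_of i))%:R) *+ (i == j)
                  - (sedge (vertex_of i) (vertex_of j))%:R) =
  block_mx
    (block_mx (('X - n.+1%:R)%:M - star_Q _ n) (-1)%:M (-1)%:M ('X - n.+1%:R)%:M)
    (- col_mx J J) (- (col_mx J J)^T) ('X - 2)%:M :> 'M[{poly R}]_(_).
Proof.
apply/matrixP => i j; rewrite [LHS]mxE.
case: (split_ordP i) => [i' ->|l ->]; case: (split_ordP j) => [j' ->|l' ->].
- rewrite block_mxEul (inj_eq (@lshift_inj _ _)).
  case: (split_ordP i') => [u ->|w ->]; case: (split_ordP j') => [v ->|w' ->];
    rewrite ?vertex_of_base ?vertex_of_center.
  + rewrite block_mxEul degree_corona_inl (inj_eq (@lshift_inj _ _)) card_ord.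
    rewrite mxE [X in _ = X + _]mxE [X in _ = _ + X]mxE star_QE natrD opprD.
    by rewrite addrA addrAC mulrnBl opprD addrA.
  + rewrite block_mxEur eq_lrshift add0r mxE /=.
    by case: eqP => // _; rewrite oppr0.
  + rewrite block_mxEdl eq_rlshift add0r mxE /= eq_sym.
    by case: eqP => // _; rewrite oppr0.
  + rewrite block_mxEdr (inj_eq (@rshift_inj _ _)) degree_corona_inr degree_star_center.
    by rewrite mxE /= /star_edge andbF subr0.
- rewrite block_mxEur eq_lrshift add0r mxE.
  case: (split_ordP i') => [u ->|w ->];
    rewrite ?vertex_of_base ?vertex_of_center vertex_of_leaf.
  + by rewrite col_mxEu mxE /= eq_sym.
  + by rewrite col_mxEd mxE /= andbT eq_sym.
- rewrite block_mxEdl eq_rlshift add0r 2!mxE.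
  case: (split_ordP j') => [u ->|w ->];
    rewrite ?vertex_of_base ?vertex_of_center vertex_of_leaf.
  + by rewrite col_mxEu mxE /= eq_sym.
  + by rewrite col_mxEd mxE /= andbT eq_sym.
- rewrite !vertex_of_leaf block_mxEdr (inj_eq (@rshift_inj _ _)).
  rewrite degree_corona_inr degree_star_leaf mxE /=.
  by rewrite /star_edge /= andbF subr0.
Qed.

Lemma char_poly_corona_stars :
  char_poly (signless_laplacian R (corona (star n.+1) (star n.+1))) =
  ('X - 2) ^+ (n.+1 * n.-1) * (corona_cubic n.+1 0 *
    corona_cubic n.+1 1 ^+ n.-1 * corona_cubic n.+1 n.+1%:R).
Proof.
pose x : {poly R} := 'X; pose K : {poly R} := n.+1%:R.
pose cubic : {poly R} -> {poly R} := corona_cubic n.+1.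
rewrite -/x -/K -/cubic.
have Xsub_neq0 (c : R) : x - c%:P != 0 by rewrite polyXsubC_eq0.
have x2 : x - 2 != 0 by have := Xsub_neq0 2; rewrite polyC_natr.
(* The scalar (x - 2) (x - K) - n left on the block of the centres once the leaves are
   eliminated. *)
pose d := (x - 1) * (x - 1 - K).
have d_neq0 : d != 0.
  rewrite mulf_neq0//; first exact: (Xsub_neq0 1).
  by rewrite -addrA -opprD /K -polyC1 -polyC_natr -polyCD.
(* The pencil lemma requires a - b = (x - 2) f_1 to be nonzero; f_1 takes the value (n - 1)^2 at 1,
   nonzero as n > 1. *)
have cubic1_neq0 : cubic 1 != 0.
  have -> : cubic 1 = (x - 1%:P) * ((x - K - 1) * (x - 1 - K) - K)
      + ((n.+1%:R - 2) ^+ 2)%:P.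
    by rewrite polyC_exp polyCB !polyC_natr /cubic /corona_cubic -/x -/K; ring.
  apply/eqP => /(congr1 (horner^~ 1)) /eqP.
  rewrite hornerD hornerM hornerXsubC subrr mul0r add0r hornerC horner0.
  have -> : n.+1%:R - 2 = n.-1%:R :> R.
    by rewrite -[n in n.+1](prednK (ltnW n_ge2)) -addn2 natrD addrK.
  by rewrite expf_eq0/= pnatr_eq0 -subn1 subn_eq0 leqNgt n_ge2.
(* The second elimination produces d^2 - (x + K - 3)^2 as scalar part; x - 2 divides it because d +
   x + K - 3 = (x - 2) (x - K + 1). *)
pose a := (x - 2) * (d * (x - K) - K * (x - 1) + (K - 2) ^+ 2).
pose b := (x - 2) * d.
have cubicE q : a - b * q = (x - 2) * cubic q.
  by rewrite /a /b /d /cubic /corona_cubic -/x -/K; ring.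
have := cubicE 0; have := cubicE 1; rewrite mulr0 subr0 mulr1 => ab a0.
have := @det_star_pencil _ n a b (ltnW n_ge2).
rewrite ab cubicE mulf_neq0// => /(_ isT).
rewrite (char_poly_signless _ vertex_of_inj card_vertices) charmx_blocks.
move: (star_Q _ n) => Q detQ.
(* First elimination, of the leaves, with [mulJJ] evaluating the product of the off-diagonal
   blocks. *)
apply: (mulIf (expf_neq0 (n.+1 + n.+1) x2)); rewrite det_block_scalar.
rewrite tr_col_mx mulNmx mulmxN opprK mul_col_row mulJJ scale_block_mx.
rewrite opp_block_mx add_block_mx !scale_scalar_mx -/x -/K.
have -> : ((x - 2) * (x - K))%:M - n%:R%:M = d%:M :> 'M[{poly R}]_(n.+1).
  by rewrite -raddfB /d /K -natr1; congr (_%:M); ring.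
have -> : ((x - 2) * -1)%:M - n%:R%:M = (- (x + K - 3))%:M :> 'M[{poly R}]_(n.+1).
  by rewrite -raddfB /K -natr1; congr (_%:M); ring.
(* Second elimination, of the centres. *)
apply: (mulIf (expf_neq0 n.+1 d_neq0)).
rewrite mulrAC det_block_scalar.
have -> : d *: ((x - 2) *: ((x - K)%:M - Q) - n%:R%:M)
    - (- (x + K - 3))%:M *m (- (x + K - 3))%:M = a%:M - b *: Q.
  rewrite -scalar_mxM; apply/matrixP => i j; rewrite !mxE.
  case: (i == j); rewrite ?mulr1n ?mulr0n /a /b /d /K -natr1; ring.
(* Count of x - 2: (n + 1) n from the leaf block and n + 1 from the pencil, less the 2 (n + 1)
   introduced to eliminate, leaves (n + 1) (n - 1). *)
rewrite detQ a0 -/K card_prod !card_ord.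
have [m ->] : exists m, n = m.+1 by exists n.-1; rewrite prednK// ltnW.
rewrite mulnS -[m.+1.-1]/m.
move: (m.+2 * m)%N (cubic 0) (cubic 1) (cubic K) (d ^+ m.+2) (x - 2).
by move=> e c0 c1 cK D X; rewrite !exprD !exprS !exprMn; ring.
Qed.

End CoronaOfStars.

(** * The spectrum of the star, and assembly of the result *)

Lemma star_spectrumE (R : realType) n (q : seq R) : (0 < n)%N -> sorted <=%R q ->
  is_spectrum (signless_laplacian R (star n.+1)) q ->
  q = 0 :: rcons (nseq n.-1 1) n.+1%:R.
Proof.
(* The polynomial determines its roots up to order, and sorting fixes the order. *)
move=> n_gt0 q_sorted q_spec; apply: (le_sorted_eq q_sorted).
  have sortedP m (x c : R) : x <= 1 -> 1 <= c ->
      path <=%R x (nseq m 1) && (last x (nseq m 1) <= c).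
    move=> x1 c1; elim: m x x1 => [|m IHm] x x1 /=; first exact: le_trans c1.
    by rewrite x1 IHm.
  by rewrite /= rcons_path sortedP// ler1n.
apply: prod_XsubC_eq; rewrite -q_spec char_poly_star// big_cons big_rcons/=.
rewrite big_nseq iter_mulr_1.
by rewrite polyC0 subr0 polyC1 polyC_natr mulrA.
Qed.

Theorem theorem8 (R : realType) (k : nat) (hk : (3 <= k)%N) (q : k.-tuple R)
    (q_sorted : sorted <=%R q)
    (q_spec : is_spectrum (signless_laplacian R (star k)) q) :
  is_spectrum (signless_laplacian R (corona (star k) (star k)))
    ([seq lambda_y k x y | x <- q, y <- [:: 0; 2; 4]%N]
     ++ flatten [seq nseq k (q`_j + 1) | j <- iota 1 (k - 2)])
  /\ (forall (i : 'I_k) (y : nat), y \in [:: 0; 2; 4]%N ->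
        let qi := tnth q i in
        let A : R := k%:R - 2 in
        let B : R := (k%:R + 1) ^+ 2 in
        let Y : R := 2 * k%:R + 2 in
        let S : R := Num.sqrt (4 * B - A ^+ 2) in
        - qi + 2 * qi / 3 + (Y - (A + S)) / 3 <= lambda_y k qi y
          <= qi + (Y + A + S) / 3).

Proof.
case: k hk q q_sorted q_spec => [//|n] n2 q q_sorted q_spec.
have n_gt1 : (1 < n)%N by [].
have qE := star_spectrumE (ltnW n_gt1) q_sorted q_spec.
split.
  rewrite /is_spectrum big_cat big_allpairs_dep big_flatten big_map.
  under eq_bigr => x _ do rewrite prod_lambda//.
  rewrite (char_poly_corona_stars _ n_gt1) mulrC; congr (_ * _).
    rewrite qE big_cons big_rcons big_nseq iter_mulr_1/=.
    by rewrite polyC0 polyC1 polyC_natr mulrA.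
  (* Indices of [q] start at 0, so 1, ..., n - 1 are exactly the positions of the eigenvalue 1, and
     every q_j + 1 here equals 2. *)
  transitivity (\prod_(j <- iota 1 (n.+1 - 2)) ('X - 2) ^+ n.+1 : {poly R}).
    by rewrite big_const_seq count_predT size_iota iter_mulr_1 -exprM subSS subn1.
  apply: eq_big_seq => j; rewrite mem_iota subSS subn1 qE.
  case: j => // j /andP[_]; rewrite add1n ltnS => jn.
  rewrite big_nseq iter_mulr_1 /= nth_rcons size_nseq jn nth_nseq jn.
  by rewrite polyCD polyC1.
move=> i y _ /=.
have qi0 : 0 <= tnth q i.
  have : tnth q i \in tval q by exact: mem_tnth.
  rewrite qE inE mem_rcons inE mem_nseq.
  by case/or3P => [/eqP->|/eqP->|/andP[_ /eqP->]].
exact: lambda_bounds.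
Qed.
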